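(* For every complete multipartite graph $G$ with at least two parts and every coloring of the edges of $G$ with $2$ colors, there exist two monochromatic subgraphs $H_1,H_2$ of $G$, each of diameter at most three, such that $V(H_1)\cup V(H_2)=V(G)$.
   Context: All graphs are finite. A complete multipartite graph with $k$ parts has its vertex set partitioned into $k$ nonempty parts, with two vertices adjacent exactly when they lie in different parts. A $2$-coloring is an arbitrary assignment of one of two colors to each edge. A subgraph $H$ (with nonempty vertex set, not necessarily induced) is monochromatic if all its edges have the same color; a single-vertex subgraph is allowed and counts as monochromatic in either color. A graph $H$ has diameter at most $k$ if every two of its vertices are at distance at most $k$ in $H$ itself (so $H$ is connected). The two subgraphs may have the same or different colors and need not be disjoint. *)

(* Defs.v *)
From mathcomp Require Import all_boot.

Set Implicit Arguments.
Unset Strict Implicit.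
Unset Printing Implicit Defensive.

Record sgraph := SGraph {
  vertex :> finType;
  adj : rel vertex;
  adj_sym : symmetric adj;
  adj_irrefl : irreflexive adj
}.

Definition edges (G : sgraph) : {set {set G}} :=
  [set E : {set G} | [exists x, exists y, adj x y && (E == [set x; y])]].

Lemma in_edges (G : sgraph) (x y : G) : ([set x; y] \in edges G) = adj x y.
Proof.
rewrite inE; apply/existsP/idP => [[u /existsP[v /andP[uv /eqP Exy]]]|xy]; last first.
  by exists x; apply/existsP; exists y; rewrite xy eqxx.
have neq_uv : u != v by apply: contraTneq uv => ->; rewrite adj_irrefl.
have: u \in [set x; y] by rewrite Exy set21.
have: v \in [set x; y] by rewrite Exy set22.
case/set2P=> ev; case/set2P=> eu; move: uv neq_uv; rewrite ev eu ?eqxx //.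
by rewrite adj_sym.
Qed.

(* [partition] already requires the parts to be nonempty and disjoint. *)
Definition complete_multipartite (G : sgraph) (k : nat) : Prop :=
  exists P : {set {set G}},
    [/\ partition P [set: G], #|P| = k &
        forall x y : G, adj x y = (pblock P x != pblock P y)].

(* The two colors are the booleans. A coloring is a total function on sets of
   vertices, but only its values on [edges G] are ever used. *)
Definition coloring (G : sgraph) : Type := {set G} -> bool.

Record subgraph (G : sgraph) := Subgraph {
  sub_verts : {set G};
  sub_edges : {set {set G}};
  sub_verts_neq0 : sub_verts != set0;
  sub_edges_subset : sub_edges \subset edges G;
  sub_edges_verts : forall E, E \in sub_edges -> E \subset sub_verts
}.

Definition monochromatic (G : sgraph) (c : coloring G) (H : subgraph G) : Prop :=
  exists a : bool, forall E, E \in sub_edges H -> c E = a.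

Definition sub_adj (G : sgraph) (H : subgraph G) : rel G :=
  fun x y => [set x; y] \in sub_edges H.

Definition walk_of_length (G : sgraph) (H : subgraph G) (x y : G) (n : nat) : Prop :=
  exists p : seq G, [/\ path (sub_adj H) x p, last x p = y & size p = n].

(* A relation rather than a function: vertices in different components of [H]
   are at no finite distance. *)
Definition is_distance (G : sgraph) (H : subgraph G) (x y : G) (d : nat) : Prop :=
  walk_of_length H x y d /\ forall n, walk_of_length H x y n -> d <= n.

Definition diameter_at_most (G : sgraph) (k : nat) (H : subgraph G) : Prop :=
  forall x y : G, x \in sub_verts H -> y \in sub_verts H ->
    exists2 d, is_distance H x y d & d <= k.

(* Main.v *)
Require Import Defs.
From mathcomp Require Import all_boot all_order all_algebra.
From mathcomp Require Import lra.

(* Merging parts, we may assume that G is complete bipartite with sides X and Y.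
   A pair of sets A, B on the two sides in which any two vertices of the same
   side have a common neighbor of color a spans a subgraph of color a and
   diameter at most 3, for instance when A and B are the neighborhoods of the
   ends of an edge. Choosing such double stars suitably settles all cases but
   one, up to symmetry: any two vertices of Y have common neighbors in both
   colors, and every x in X has a complement x' colored oppositely to all of Y.
   Then fix y0 in Y and let X1 and X2 be its neighborhoods in the two colors,
   so that complementation exchanges X1 and X2. Let M be the +1/-1 matrix of
   the coloring on X1 x Y. By linear programming duality there is a weight
   p >= 0, p != 0 on X1 such that either pM >= 0, or p > 0 and some weight q >= 0 on
   the columns with pM < 0 satisfies Mq < 0. In the second case split Y by the
   sign of pM and use the blue pairs (X1, {pM >= 0}) and (X2, {pM < 0}): common
   neighbors exist because two majorities intersect, a tie being impossible as
   it would make two columns opposite. In the first case split Y by the color of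
   its edges to a vertex of positive weight. *)

Set Implicit Arguments.
Unset Strict Implicit.
Unset Printing Implicit Defensive.

(** * Theorems of the alternative for finite systems of linear inequalities *)

Section Ville.
Import Order.TTheory GRing.Theory Num.Theory.
Local Open Scope ring_scope.
Variable F : realFieldType.

Lemma exists_separating_point (I : finType) (P Q : pred I) (l u : I -> F) :
    (forall i, P i -> 0 < u i) -> (forall i k, P i -> Q k -> l k < u i) ->
  exists2 x, 0 <= x & (forall i, P i -> x < u i) /\ (forall k, Q k -> l k < x).
Proof.
move=> u0 lu; pose L := \big[Num.max/0]_(k | Q k) l k.
(* The default [L + 1] keeps [U] above [L] when [P] is empty; the default [0] in [L] makes the
   midpoint nonnegative. *)
pose U := \big[Num.min/(L + 1)]_(i | P i) u i.
have L0 : 0 <= L by exact: bigmax_ge_id.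
have LU : L < U.
  apply: lt_bigmin => [|i Pi]; first by rewrite ltrDl.
  by apply: bigmax_lt => [|k Qk]; [exact: u0 | exact: lu].
exists ((L + U) / 2); first by lra.
split=> [i Pi|k Qk].
  by have := bigmin_le_cond (L + 1) u Pi; rewrite -/U => ?; lra.
by have := le_bigmax_cond 0 l Qk; rewrite -/L => ?; lra.
Qed.

(* Fourier-Motzkin elimination of the last column: the rows [g x] generate the
   cone of the [p >= 0] whose product with that column is nonnegative. *)
Lemma ville_nat n : forall (I : finType) (M : I -> nat -> F),
  (exists p : I -> F, [/\ forall i, 0 <= p i, exists i, 0 < p i &
      forall j, (j < n)%N -> 0 <= \sum_i p i * M i j]) \/
  (exists2 q : nat -> F, forall j, 0 <= q j &
      forall i, \sum_(j < n) M i j * q j < 0).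
Proof.
elim: n => [|n IHn] I M.
  case: (pickP (@predT I)) => [i0 _|I0]; last first.
    by right; exists (fun=> 0) => // i; have := I0 i.
  by left; exists (fun=> 1); split=> //; exists i0.
pose c i := M i n.
pose I1 := {i | 0 <= c i}.
pose I2 := {ik : I * I | (0 < c ik.1) && (c ik.2 < 0)}.
pose g (x : I1 + I2) (i : I) : F :=
  match x with
  | inl i1 => (i == val i1)%:R
  | inr ik => - c (val ik).2 * (i == (val ik).1)%:R
              + c (val ik).1 * (i == (val ik).2)%:R
  end.
have g0 x i : 0 <= g x i.
  case: x => [i1|[[i1 k] /= /andP[i10 k0]]] /=; first exact: ler0n.
  by rewrite addr_ge0 // mulr_ge0 ?ler0n // ?oppr_ge0 ltW.
have sum_g (h : I -> F) x : \sum_i g x i * h i =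
    match x with
    | inl i1 => h (val i1)
    | inr ik => - c (val ik).2 * h (val ik).1 + c (val ik).1 * h (val ik).2
    end.
  have delta (k : I) : \sum_i (i == k)%:R * h i = h k.
    rewrite (bigD1 k) //= eqxx mul1r big1 ?addr0 // => i /negPf->.
    by rewrite mul0r.
  case: x => [i1|ik] /=; first exact: delta.
  under eq_bigr do rewrite mulrDl -!mulrA.
  by rewrite big_split -!mulr_sumr /= !delta.
have [[p [p0 [x0 px0] pM]]|[q q0 qM]] :=
    IHn _ (fun x j => \sum_i g x i * M i j).
  left; exists (fun i => \sum_x p x * g x i).
  have E j : \sum_i (\sum_x p x * g x i) * M i j =
             \sum_x p x * \sum_i g x i * M i j.
    under eq_bigr do rewrite mulr_suml.
    rewrite exchange_big; apply: eq_bigr => x _ /=; rewrite mulr_sumr.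
    by apply: eq_bigr => i _; rewrite mulrA.
  split=> [i||j]; first by apply: sumr_ge0 => x _; rewrite mulr_ge0.
    have [i gi] : exists i, 0 < g x0 i.
      case: x0 {px0} => [[i i0]|[[i k] /= /andP[i0 k0]]]; exists i => /=.
        by rewrite eqxx ltr01.
      by rewrite eqxx mulr1 ltr_wpDr ?oppr_gt0 // mulr_ge0 ?ler0n // ltW.
    exists i; rewrite (bigD1 x0) //= ltr_wpDr ?mulr_gt0 //.
    by apply: sumr_ge0 => x _; rewrite mulr_ge0.
  rewrite E ltnS leq_eqVlt => /predU1P[->|/pM//].
  apply: sumr_ge0 => x _; rewrite mulr_ge0 // (sum_g c).
  case: x => [[i i0]|[[i k] /= /andP[i0 k0]]] //=.
  by rewrite mulNr [c k * _]mulrC addNr.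
pose a i := \sum_(j < n) M i j * q j.
have qg x : \sum_i g x i * a i < 0.
  have := qM x; congr (_ < _).
  under eq_bigr do rewrite mulr_suml.
  rewrite exchange_big; apply: eq_bigr => i _; rewrite /a mulr_sumr.
  by apply: eq_bigr => j _; rewrite mulrA.
have a1 i : 0 <= c i -> a i < 0.
  by move=> i0; have := qg (inl (exist _ i i0)); rewrite sum_g.
have a2 i k : 0 < c i -> c k < 0 -> - c k * a i + c i * a k < 0.
  move=> i0 k0; have ik : (0 < c (i, k).1) && (c (i, k).2 < 0) by rewrite i0.
  by have := qg (inr (exist _ (i, k) ik)); rewrite sum_g.
(* The weight [x] of the last column must give [a i + c i * x < 0] for every [i]: an upper bound on
   [x] where [c i > 0], a lower bound where [c i < 0]. By [a2] these bounds are compatible. *)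
have [|i k i0 k0|x x0 [xu xl]] := @exists_separating_point I
    (fun i => 0 < c i) (fun i => c i < 0)
    (fun k => a k / - c k) (fun i => - a i / c i).
- by move=> i i0; rewrite divr_gt0 // oppr_gt0 a1 // ltW.
- rewrite ltr_pdivrMr ?oppr_gt0 // mulrAC ltr_pdivlMr //.
  by have := a2 i k i0 k0 => ?; lra.
right; exists (fun j => if j == n then x else q j) => [j|i].
  by case: ifP.
rewrite big_ord_recr /= eqxx.
under eq_bigr => j _ do rewrite (ltn_eqF (ltn_ord j)).
rewrite -/(a i) -/(c i).
case: (ltrgtP 0 (c i)) => [i0|i0|i0].
- by have := xu i i0; rewrite ltr_pdivlMr // => ?; lra.
- by have := xl i i0; rewrite ltr_pdivrMr ?oppr_gt0 // => ?; lra.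
- by rewrite -i0 mul0r addr0 a1 // -i0.
Qed.

Lemma ville (I J : finType) (M : I -> J -> F) :
  (exists p : I -> F, [/\ forall i, 0 <= p i, exists i, 0 < p i &
      forall j, 0 <= \sum_i p i * M i j]) \/
  (exists2 q : J -> F, forall j, 0 <= q j & forall i, \sum_j M i j * q j < 0).
Proof.
pose N i k := if insub k is Some k' then M i (@enum_val J predT k') else 0.
have NE i (k : 'I_#|J|) : N i k = M i (enum_val k) by rewrite /N valK.
have [[p [p0 p1 pN]]|[q q0 qN]] := ville_nat #|J| N.
  left; exists p; split=> // j.
  have := pN _ (ltn_ord (enum_rank j)); under eq_bigr do rewrite NE enum_rankK.
  by [].
right; exists (fun j => q (enum_rank j)) => // i.
have := qN i; rewrite (reindex (@enum_rank J)) /=; last exact/onW_bij/enum_rank_bij.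
by under eq_bigr do rewrite NE enum_rankK.
Qed.

(* If the [q] of [ville] has minimal support, a second application of [ville],
   to the columns in that support, yields [p]. *)
Lemma ville_complementary (I J : finType) (M : I -> J -> F) :
  (exists p : I -> F, [/\ forall i, 0 <= p i, exists i, 0 < p i &
      forall j, 0 <= \sum_i p i * M i j]) \/
  (exists (p : I -> F) (q : J -> F),
    [/\ forall i, 0 < p i, forall j, 0 <= q j,
        forall i, \sum_j M i j * q j < 0 &
        forall j, 0 < q j -> \sum_i p i * M i j < 0]).
Proof.
have [|[q]] := ville M; [by left | move=> q0 qM; right].
have [m] := ubnP #|[pred j | 0 < q j]|.
elim: m => // m IHm in q q0 qM *; rewrite ltnS => qm.
pose T := {j | 0 < q j}.
(* The [inl] rows are the columns of [M] in the support of [q]; the [inr] rows form minus the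
   identity, which forces [p > 0] in the second alternative. *)
pose N (x : T + I) (i : I) : F :=
  match x with inl j => M i (val j) | inr k => - (i == k)%:R end.
have [[r [r0 [x0 rx0] rN]]|[p p0 pN]] := ville N; last first.
  exists p, q; split=> // [i|j qj].
    have := pN (inr i); rewrite (bigD1 i) //= eqxx big1.
      by rewrite addr0 mulN1r oppr_lt0.
    by move=> k /negPf->; rewrite oppr0 mul0r.
  have := pN (inl (exist _ j qj)); congr (_ < _).
  by apply: eq_bigr => i _; rewrite mulrC.
pose s j := if insub j is Some t then r (inl t) else 0.
have s0 j : 0 <= s j by rewrite /s; case: insub.
have sq j : 0 < s j -> 0 < q j by rewrite /s; case: insubP => // _; rewrite ltxx.
have rs i : r (inr i) <= \sum_j M i j * s j.
  have := rN i; rewrite big_sumType /= [X in _ + X](bigD1 i) //= eqxx.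
  rewrite [X in _ + (_ + X)]big1 ?addr0; last first.
    by move=> k; rewrite eq_sym => /negPf->; rewrite oppr0 mulr0.
  rewrite mulrN1 subr_ge0 => /le_trans; apply.
  rewrite [leRHS](bigID (fun j => 0 < q j)) /= [X in _ + X]big1 ?addr0.
    rewrite (reindex_omap (fun t : T => val t) insub) /=; last first.
      by move=> j qj; rewrite insubT.
    rewrite big_mkcond /= [leRHS]big_mkcond /=; apply: ler_sum => t _.
    by rewrite (valP t) valK eqxx /s valK mulrC.
  move=> j qj; case: (ltrgtP 0 (s j)) (s0 j) => // [sj|<-] _; last by rewrite mulr0.
  by rewrite (sq j sj) in qj.
have [j0 sj0] : exists j, 0 < s j.
  case: x0 rx0 => [t rt|i ri]; first by exists (val t); rewrite /s valK.
  apply/existsP; rewrite -[[exists _, _]]negbK negb_exists; apply/forallP => sN.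
  have := lt_le_trans ri (rs i); rewrite big1 ?ltxx // => j _.
  by case: (ltrgtP 0 (s j)) (s0 j) (sN j) => // <-; rewrite mulr0.
(* Since [M s >= 0], subtracting a multiple of [s] from [q] keeps [M q < 0]. The least ratio
   [q j / s j] is the largest multiple that keeps [q >= 0], and it removes [j1] from the support. *)
case: (@arg_minP _ _ _ j0 (fun j => 0 < s j) (fun j => q j / s j) sj0).
move=> j1 sj1 minj1; set e := q j1 / s j1 in minj1.
have e0 : 0 <= e by rewrite divr_ge0.
apply: (IHm (fun j => q j - e * s j)) => [j|i|].
- rewrite subr_ge0; case: (ltrgtP 0 (s j)) (s0 j) => // [sj|<-] _.
    by rewrite -ler_pdivlMr // minj1.
  by rewrite mulr0.
- under eq_bigr do rewrite mulrBr mulrCA.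
  rewrite sumrB -mulr_sumr; apply: le_lt_trans (qM i).
  by rewrite gerBl mulr_ge0 // (le_trans _ (rs i)).
apply: leq_trans qm; apply/proper_card/properP; split.
  apply/subsetP => j; rewrite !inE subr_gt0; apply: le_lt_trans.
  by rewrite mulr_ge0.
exists j1; rewrite !inE ?sq // /e divfK ?subrr ?ltxx //.
by rewrite gt_eqF.
Qed.
End Ville.

(** * Blocks and double stars in two-colored complete bipartite graphs *)

Definition common_nbr (X Y : finType) (f : X -> Y -> bool) (a : bool) (x x' : X) :=
  [exists y, (f x y == a) && (f x' y == a)].

(** The pairs with [x = x'] count too: they give each vertex a neighbor inside the block, and hence
    make [B] nonempty. *)
Definition block (X Y : finType) (f : X -> Y -> bool) a (A : {set X}) (B : {set Y}) :=
  [/\ A != set0,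
      {in A &, forall x x', exists2 y, y \in B & f x y = a /\ f x' y = a} &
      {in B &, forall y y', exists2 x, x \in A & f x y = a /\ f x y' = a}].

Definition two_blocks (X Y : finType) (f : X -> Y -> bool) :=
  exists a1 A1 B1 a2 A2 B2,
    [/\ block f a1 A1 B1, block f a2 A2 B2,
        A1 :|: A2 = [set: X] & B1 :|: B2 = [set: Y]].

Lemma common_nbrP (X Y : finType) (f : X -> Y -> bool) a x x' :
  reflect (exists2 y, f x y = a & f x' y = a) (common_nbr f a x x').
Proof.
apply: (iffP existsP) => [[y /andP[/eqP ? /eqP ?]]|[y fx fx']]; first by exists y.
by exists y; rewrite fx fx' eqxx.
Qed.

Lemma not_common_nbr (X Y : finType) (f : X -> Y -> bool) a x x' y :
  ~~ common_nbr f a x x' -> f x y = a -> f x' y = ~~ a.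
Proof.
move=> /existsPn/(_ y); rewrite negb_and => /orP[/eqP//|].
by case: (f x' y); case: a.
Qed.

Lemma block_swap (X Y : finType) (f : X -> Y -> bool) a A B :
  block f a A B -> block (fun y x => f x y) a B A.
Proof.
case=> /set0Pn[x xA] rows cols; split=> //.
by have [y yB _] := rows x x xA xA; apply/set0Pn; exists y.
Qed.

Lemma two_blocks_swap (X Y : finType) (f : X -> Y -> bool) :
  two_blocks (fun y x => f x y) -> two_blocks f.
Proof.
case=> [a1 [A1 [B1 [a2 [A2 [B2 [/block_swap b1 /block_swap b2 A12 B12]]]]]]].
by exists a1, B1, A1, a2, B2, A2.
Qed.

Lemma block_star (X Y : finType) (f : X -> Y -> bool) a x y :
  f x y = a -> block f a [set x' | f x' y == a] [set y' | f x y' == a].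
Proof.
move=> fxy; split=> [|x1 x2|y1 y2]; rewrite ?inE.
- by apply/set0Pn; exists x; rewrite inE fxy.
- by move=> /eqP ? /eqP ?; exists y; rewrite // inE fxy.
- by move=> /eqP ? /eqP ?; exists x; rewrite // inE fxy.
Qed.

Lemma two_stars (X Y : finType) (f : X -> Y -> bool) a x1 y1 b x2 y2 :
    f x1 y1 = a -> f x2 y2 = b ->
    (forall x, f x y1 = a \/ f x y2 = b) ->
    (forall y, f x1 y = a \/ f x2 y = b) ->
  two_blocks f.
Proof.
move=> f1 f2 cX cY.
exists a, [set x | f x y1 == a], [set y | f x1 y == a].
exists b, [set x | f x y2 == b], [set y | f x2 y == b].
split; [exact: block_star | exact: block_star | |]; apply/setP => z; rewrite !inE.
  by case: (cX z) => ->; rewrite eqxx ?orbT.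
by case: (cY z) => ->; rewrite eqxx ?orbT.
Qed.

Lemma bool_neqN (a b : bool) : b <> a -> b = ~~ a.
Proof. by case: a b => [] []. Qed.

(** The stars of the edges [x y] and [x' y] have different colors and share the end [y], so they
    cover all rows; the inclusion makes them cover all columns. *)
Lemma two_blocks_row_inclusion (X Y : finType) (f : X -> Y -> bool) a x x' y :
    (forall y', f x y' = a -> f x' y' = a) -> f x y <> a -> f x' y = a ->
  two_blocks f.
Proof.
move=> sub fx fx'; apply: (@two_stars _ _ f (~~ a) x y a x' y) => // [|z|y'].
- exact: bool_neqN.
- by case: (eqVneq (f z y) a) => [|/eqP/bool_neqN]; [right | left].
- by case: (eqVneq (f x y') a) => [/sub|/eqP/bool_neqN]; [right | left].
Qed.

(** Among the four edges between [x, x'] and [y, y'], no two of color [a] share an end, so one of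
    the two perfect matchings has color [~~ a] throughout. The stars of its edges cover
    everything. *)
Lemma two_blocks_same_color (X Y : finType) (f : X -> Y -> bool) a x x' y y' :
  ~~ common_nbr f a x x' -> ~~ common_nbr (fun y x => f x y) a y y' -> two_blocks f.
Proof.
move=> mx my.
have cX z : f z y = ~~ a \/ f z y' = ~~ a.
  by case: (eqVneq (f z y) a) => [/(not_common_nbr my)|/eqP/bool_neqN]; [right | left].
have cY z : f x z = ~~ a \/ f x' z = ~~ a.
  by case: (eqVneq (f x z) a) => [/(not_common_nbr mx)|/eqP/bool_neqN]; [right | left].
have [xy|/eqP/bool_neqN xy] := eqVneq (f x y) a.
  apply: (@two_stars _ _ f (~~ a) x y' (~~ a) x' y) => //.
  - exact: not_common_nbr my xy.
  - exact: not_common_nbr mx xy.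
  - by move=> z; have [] := cX z; [right | left].
have [xy'|/eqP/bool_neqN xy'] := eqVneq (f x' y') a; last first.
  exact: (@two_stars _ _ f (~~ a) x y (~~ a) x' y').
have xNy' : f x y' = ~~ a.
  by case: (cY y') => //; rewrite xy'; case: (a).
have xNy : f x' y = ~~ a.
  by case: (cX x') => //; rewrite xy'; case: (a).
apply: (@two_stars _ _ f (~~ a) x y' (~~ a) x' y) => //.
by move=> z; have [] := cX z; [right | left].
Qed.

(* The star of the edge [x y] is complemented by the block of the other color
   spanned by the remaining vertices together with [x] and [y]. *)
Lemma two_blocks_complement_star (X Y : finType) (f : X -> Y -> bool) a x y :
    f x y = ~~ a ->
    common_nbr f a x x -> (forall x', f x' y = a -> common_nbr f a x x') ->
    common_nbr (fun y x => f x y) a y y ->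
    (forall y', f x y' = a -> common_nbr (fun y x => f x y) a y y') ->
  two_blocks f.
Proof.
move=> fxy mxx mx myy my.
exists (~~ a), [set x' | f x' y == ~~ a], [set y' | f x y' == ~~ a].
exists a, (x |: [set x' | f x' y == a]), (y |: [set y' | f x y' == a]).
split; first exact: block_star.
- split=> [|x1 x2|y1 y2]; first by apply/set0Pn; exists x; rewrite !inE eqxx.
  + rewrite !inE => /predU1P[->|/eqP x1y] /predU1P[->|/eqP x2y].
    * by have /common_nbrP[z z1 z2] := mxx; exists z; rewrite // !inE z1 eqxx orbT.
    * by have /common_nbrP[z z1 z2] := mx _ x2y; exists z; rewrite // !inE z1 eqxx orbT.
    * by have /common_nbrP[z z1 z2] := mx _ x1y; exists z; rewrite // !inE z1 eqxx orbT.
    * by exists y; rewrite // !inE eqxx.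
  + rewrite !inE => /predU1P[->|/eqP y1x] /predU1P[->|/eqP y2x].
    * by have /common_nbrP[z z1 z2] := myy; exists z; rewrite // !inE z1 eqxx orbT.
    * by have /common_nbrP[z z1 z2] := my _ y2x; exists z; rewrite // !inE z1 eqxx orbT.
    * by have /common_nbrP[z z1 z2] := my _ y1x; exists z; rewrite // !inE z1 eqxx orbT.
    * by exists x; rewrite // !inE eqxx.
- by apply/setP => z; rewrite !inE orbCA; case: (f z y) (a) => [] [] /=; rewrite orbT.
- by apply/setP => z; rewrite !inE orbCA; case: (f x z) (a) => [] [] /=; rewrite orbT.
Qed.

(** A common [a]-neighbor [y] of [x] and [x'] shares an [a]-neighbor with every column [y']:
    otherwise [y'] would be a common neighbor of [x] and [x'] in color [~~ a]. An edge of color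
    [~~ a] at [y] then has a complemented star. *)
Lemma two_blocks_opposite_colors (X Y : finType) (f : X -> Y -> bool) a x x' :
    (forall x1 x2, common_nbr f a x1 x2) -> ~~ common_nbr f (~~ a) x x' ->
    (forall y1 y2, common_nbr (fun y x => f x y) (~~ a) y1 y2) ->
  two_blocks f.
Proof.
move=> mX mx mY; have /common_nbrP[y xy x'y] := mX x x'.
have my y' : common_nbr (fun y x => f x y) a y y'.
  apply: contraNT mx => myy'; apply/common_nbrP; exists y'.
    exact: not_common_nbr myy' xy.
  exact: not_common_nbr myy' x'y.
have /common_nbrP[z zy _] := mY y y.
exact: (@two_blocks_complement_star _ _ f a z y).
Qed.

(** * The case where every row has a complementary row *)

Section ComplementaryRows.
Import Order.TTheory GRing.Theory Num.Theory.
Local Open Scope ring_scope.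
Variables (X Y : finType) (f : X -> Y -> bool).
Hypothesis col_nbr : forall a y y', common_nbr (fun y x => f x y) a y y'.
Variable compl : X -> X.
Hypothesis complE : forall x y, f (compl x) y = ~~ f x y.

Lemma two_blocks_complementary_rows (y0 : Y) : two_blocks f.
Proof.
pose I := {x | f x y0}.
pose M (i : I) y : rat := if f (val i) y then 1 else -1.
have M_le i y y' : ~~ (f (val i) y && f (val i) y') -> M i y + M i y' <= 0.
  by rewrite /M; case: (f _ y); case: (f _ y').
have M_ge i y y' : f (val i) y || f (val i) y' -> 0 <= M i y + M i y'.
  by rewrite /M; case: (f _ y); case: (f _ y').
have X_neq0 a : [set x | f x y0 == a] != set0.
  by have /common_nbrP[x xy0 _] := col_nbr a y0 y0; apply/set0Pn; exists x; rewrite inE xy0.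
have [[p [p0 [[j0 j0y0] pj0] pM]]|[p [q [p0 q0 qM pM]]]] := ville_complementary M.
  exists true, [set x | f x y0 == true], [set y | f j0 y == true].
  (* Adding [y0] provides a common neighbor for all rows of this block. *)
  exists false, [set x | f x y0 == false], (y0 |: [set y | f j0 y == false]).
  split; first exact: block_star.
  - split=> [//|x1 x2|y1 y2].
      by rewrite !inE => /eqP ? /eqP ?; exists y0; rewrite // !inE eqxx.
    have hub y : exists2 x, x \in [set x | f x y0 == false] &
        f x y0 = false /\ f x y = false.
      by have /common_nbrP[x xy0 xy] := col_nbr false y0 y; exists x; rewrite // inE xy0.
    rewrite !inE => /predU1P[->|/eqP j0y1]; first by move=> _; apply: hub.
    move=> /predU1P[->|/eqP j0y2].
      by have [x ? []] := hub y1; exists x.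
    (* Without such an [i], every [M i y1 + M i y2] is at most 0, and it is -2 at [j0], which has
       positive weight; this contradicts [pM]. *)
    suff [i /andP[i1 i2]] : exists i : I, f (val i) y1 && f (val i) y2.
      by exists (compl (val i)); rewrite ?inE !complE ?i1 ?i2 // (valP i).
    apply/existsP; rewrite -[[exists _, _]]negbK negb_exists; apply/negP => /forallP fN.
    have := addr_ge0 (pM y1) (pM y2); rewrite -big_split /=.
    apply/negP; rewrite -ltNge (bigD1 (exist _ j0 j0y0)) //=.
    rewrite -mulrDr {1 2}/M /= j0y1 j0y2.
    have : \sum_(i | i != exist _ j0 j0y0) (p i * M i y1 + p i * M i y2) <= 0.
      by rewrite sumr_le0 // => i _; rewrite -mulrDr mulr_ge0_le0 // M_le.
    by move: pj0; lra.
  - by apply/setP => x; rewrite !inE; case: (f x y0).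
  - by apply/setP => y; rewrite !inE orbCA; case: (f j0 y); rewrite orbT.
pose D := [set y | \sum_i p i * M i y < 0].
exists true, [set x | f x y0 == true], (~: D).
exists true, [set x | f x y0 == false], D.
split.
- split=> [//|x1 x2|y1 y2].
    rewrite !inE => /eqP x1y /eqP x2y; exists y0 => //.
    rewrite !inE -leNgt sumr_ge0 // => i _.
    by rewrite /M (valP i) mulr1 ltW.
  rewrite !inE -!leNgt => py1 py2.
  have [/existsP[i /andP[i1 i2]]|] :=
    boolP [exists i : I, f (val i) y1 && f (val i) y2].
    by exists (val i); rewrite // inE (valP i).
  rewrite negb_exists => /forallP fN.
  (* The tie: as all weights are positive, [y1] and [y2] are opposite on the rows of [I], hence by
     complementation on all rows, against [col_nbr]. *)
  have /eqP : \sum_i p i * (M i y1 + M i y2) == 0.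
    rewrite eq_le sumr_le0 /=; last by move=> i _; rewrite mulr_ge0_le0 ?M_le // ltW.
    by under eq_bigr do rewrite mulrDr; rewrite big_split addr_ge0.
  move/eqP; rewrite -oppr_eq0 -sumrN psumr_eq0; last first.
    by move=> i _; rewrite oppr_ge0 mulr_ge0_le0 ?M_le // ltW.
  move=> /allP M0.
  have opp x : f x y0 -> f x y1 = ~~ f x y2.
    move=> xy0; have := M0 (exist _ x xy0) (mem_index_enum _).
    rewrite oppr_eq0 mulf_eq0 gt_eqF //= /M /=.
    by case: (f x y1); case: (f x y2).
  have /common_nbrP[x x1 x2] := col_nbr true y1 y2.
  case xy0: (f x y0); first by have := opp x xy0; rewrite x1 x2.
  by have := opp (compl x); rewrite !complE xy0 x1 x2 => /(_ isT).
- split=> [//|x1 x2|y1 y2].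
    rewrite !inE => /eqP x1y /eqP x2y.
    have c1 : f (compl x1) y0 by rewrite complE x1y.
    have c2 : f (compl x2) y0 by rewrite complE x2y.
    pose i1 : I := exist _ (compl x1) c1; pose i2 : I := exist _ (compl x2) c2.
    (* Applied to the complements, [qM] gives both [x1] and [x2] a strict [q]-majority of color
       [true]. The majorities meet in the support of [q], which lies in [D] by [pM]. *)
    suff [y /and3P[qy y1 y2]] : exists y, [&& 0 < q y, f x1 y & f x2 y].
      by exists y; rewrite // inE pM.
    apply/existsP; rewrite -[[exists _, _]]negbK negb_exists; apply/negP => /forallP qN.
    have := ltrD (qM i1) (qM i2); rewrite -big_split addr0 /=.
    apply/negP; rewrite -leNgt sumr_ge0 // => y _; rewrite -mulrDl.
    move: (qN y); case: (ltrgtP 0 (q y)) (q0 y) => // [qy|<-] _ /=; last by rewrite mulr0.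
    move=> N12; rewrite mulr_ge0 ?(ltW qy) // /M /= !complE.
    by case: (f x1 y) N12; case: (f x2 y).
  rewrite !inE => py1 py2.
  suff [i] : exists i : I, ~~ (f (val i) y1 || f (val i) y2).
    rewrite negb_or => /andP[i1 i2].
    by exists (compl (val i)); rewrite ?inE !complE ?(negPf i1) ?(negPf i2) // (valP i).
  apply/existsP; rewrite -[[exists _, _]]negbK negb_exists; apply/negP => /forallP fN.
  have := ltrD py1 py2; rewrite -big_split addr0 /=.
  apply/negP; rewrite -leNgt sumr_ge0 // => i _; rewrite -mulrDr.
  by rewrite mulr_ge0 ?(ltW (p0 i)) // M_ge // -[_ || _]negbK fN.
- by apply/setP => x; rewrite !inE; case: (f x y0).
- by rewrite setUC setUCr.
Qed.

End ComplementaryRows.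

(** * Case analysis on the existence of common neighbors *)

Lemma two_blocks_of_columns_common_nbr (X Y : finType) (f : X -> Y -> bool) (y0 : Y) :
    (forall a y y', common_nbr (fun y x => f x y) a y y') ->
    (forall a, exists x x', ~~ common_nbr f a x x') ->
  two_blocks f.
Proof.
move=> mY nmX.
have [/existsP[a /existsP[x /forallP mx]]|] :=
    boolP [exists a, exists x, forall x', common_nbr f a x x'].
  have [y /eqP/bool_neqN xy|xa] := pickP (fun y => f x y != a).
    exact: (@two_blocks_complement_star _ _ f a x y).
  (* A row of constant color [a] includes every other row in that color, strictly for the row [v]
     found below. *)
  have {}xa y : f x y = a by have /negPn/eqP := negbT (xa y).
  have [u [u' muu']] := nmX a.
  have [v [y vy]] : exists v y, f v y <> a.
    have [uy|/eqP] := eqVneq (f u y0) a; last by exists u, y0.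
    by exists u', y0; rewrite (not_common_nbr muu' uy); case: (a).
  by apply: (@two_blocks_row_inclusion _ _ f a v x y) => // *; rewrite xa.
rewrite negb_exists => /forallP nm.
have {}nm a x : exists x', ~~ common_nbr f a x x'.
  move: (nm a); rewrite negb_exists => /forallP/(_ x).
  by rewrite negb_forall => /existsP.
have [/existsP[x /existsP[x' /existsP[y /andP[/forallP s /andP[/eqP ? /eqP ?]]]]]|] :=
    boolP [exists x, exists x', exists y,
      [forall y', f x y' ==> f x' y'] && ((f x y == false) && (f x' y == true))].
  apply: (@two_blocks_row_inclusion _ _ f true x x' y) => // [y' xy'|]; last by congruence.
  exact: implyP (s y') xy'.
move=> anti.
(* In color [true], the neighborhood of [x1] lies inside the complement of that of [x], and that of
   [x2] contains this complement. As [anti] excludes strict inclusion of rows, all three sets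
   agree. *)
have compl x : exists x', [forall y, f x' y == ~~ f x y].
  have [x1 m1] := nm true x; have [x2 m2] := nm false x.
  exists x1; apply: contraNT anti => /forallPn[y x1y].
  apply/existsP; exists x1; apply/existsP; exists x2; apply/existsP; exists y.
  apply/andP; split.
    apply/forallP => y'; apply/implyP => x1y'.
    apply: (not_common_nbr m2); apply: contraTF x1y' => xy'.
    by rewrite (not_common_nbr m1 xy').
  case xy: (f x y) x1y; first by rewrite (not_common_nbr m1 xy).
  by rewrite (not_common_nbr m2 xy) => /=; case: (f x1 y).
apply: (@two_blocks_complementary_rows _ _ f mY (fun x => xchoose (compl x))) => // x y.
exact/eqP/(forallP (xchooseP (compl x))).
Qed.

(** If [RX] and [RY] agree on some color, one block suffices or two stars do. Otherwise [RY] is the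
    negation of [RX], and it remains to ask whether [RX] depends on the color. *)
Lemma two_blocks_exist (X Y : finType) (f : X -> Y -> bool) :
  X -> Y -> two_blocks f.
Proof.
move=> x0 y0.
pose g y x := f x y.
pose RX a := [forall x, forall x', common_nbr f a x x'].
pose RY a := [forall y, forall y', common_nbr g a y y'].
have RXP a : RX a -> forall x x', common_nbr f a x x'.
  by move=> /forallP h x; apply/forallP.
have RYP a : RY a -> forall y y', common_nbr g a y y'.
  by move=> /forallP h y; apply/forallP.
have RXN a : ~~ RX a -> exists x x', ~~ common_nbr f a x x'.
  by move=> /forallPn[x /forallPn[x' h]]; exists x, x'.
have RYN a : ~~ RY a -> exists y y', ~~ common_nbr g a y y'.
  by move=> /forallPn[y /forallPn[y' h]]; exists y, y'.
have [/existsP[a /andP[/RXP rx /RYP ry]]|] := boolP [exists a, RX a && RY a].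
  have b : block f a [set: X] [set: Y].
    split=> [|x x' _ _|y y' _ _]; first by apply/set0Pn; exists x0.
      by have /common_nbrP[y] := rx x x'; exists y.
    by have /common_nbrP[x] := ry y y'; exists x.
  by exists a, setT, setT, a, setT, setT; rewrite !setUT.
rewrite negb_exists => /forallP n1.
have [/existsP[a /andP[/RXN[x [x' mx]] /RYN[y [y' my]]]]|] :=
    boolP [exists a, ~~ RX a && ~~ RY a].
  exact: two_blocks_same_color mx my.
rewrite negb_exists => /forallP n2.
have RXY a : RY a = ~~ RX a by move: (n1 a) (n2 a); case: (RX a); case: (RY a).
have [/existsP[a /andP[ra rNa]]|] := boolP [exists a, RX a && ~~ RX (~~ a)].
  have [x [x' mx]] := RXN _ rNa.
  by apply: (two_blocks_opposite_colors (RXP _ ra) mx); apply: RYP; rewrite RXY.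
rewrite negb_exists => /forallP n3.
have [rt|rt] := boolP (RX true).
  have r a : RX a by case: a => //; have := n3 true; rewrite rt negbK.
  apply/two_blocks_swap/two_blocks_of_columns_common_nbr => // [a|a]; first exact: RXP.
  by apply: RYN; rewrite RXY negbK.
have r a : ~~ RX a by case: a => //; have := n3 false; rewrite (negPf rt) andbT.
apply: two_blocks_of_columns_common_nbr => // [a|a]; last exact: RXN.
by apply: RYP; rewrite RXY.
Qed.

(** * From blocks to monochromatic subgraphs of the graph *)

Lemma distance_of_walk (G : sgraph) (H : subgraph G) x y n :
  walk_of_length H x y n -> exists2 d, is_distance H x y d & d <= n.
Proof.
(* Walks of a fixed length form a finite type, so their existence is decidable and a least length
   can be taken. *)
pose w m := [exists p : m.-tuple G, path (sub_adj H) x p && (last x p == y)].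
have wP m : reflect (walk_of_length H x y m) (w m).
  apply: (iffP existsP) => [[p /andP[xp /eqP py]]|[p [xp py sp]]].
    by exists p; rewrite size_tuple.
  have sp' : size p == m by rewrite sp.
  by exists (Tuple sp'); rewrite xp py eqxx.
move=> /wP wn; have [d /wP wd min_d] := ex_minnP (ex_intro _ n wn).
by exists d; [split=> // m /wP; apply: min_d | apply: min_d].
Qed.

Section Bipartition.
Variables (G : sgraph) (c : coloring G) (S : {set G}).
Hypothesis adjS : forall x y : G, x \in S -> y \notin S -> adj x y.

Local Notation X := {x : G | x \in S}.
Local Notation Y := {y : G | y \notin S}.

Definition cross_color (x : X) (y : Y) : bool := c [set val x; val y].

Lemma block_subgraph a (A : {set X}) (B : {set Y}) : block cross_color a A B ->
  exists2 H : subgraph G,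
    sub_verts H = [set val x | x in A] :|: [set val y | y in B] &
    monochromatic c H /\ diameter_at_most 3 H.
Proof.
case=> A0 rows cols; set V := _ :|: _.
pose E := [set [set val x; val y] | x in A, y in B & cross_color x y == a].
have V0 : V != set0.
  have /set0Pn[x xA] := A0; apply/set0Pn; exists (val x).
  by rewrite inE imset_f.
have EG : E \subset edges G.
  apply/subsetP => _ /imset2P[x y _ _ ->].
  by rewrite in_edges adjS ?(valP x) ?(valP y).
have EV e : e \in E -> e \subset V.
  move=> /imset2P[x y xA]; rewrite inE => /andP[yB _] ->.
  by rewrite subUset !sub1set !inE !imset_f ?orbT.
pose H := Subgraph V0 EG EV; exists H => //; split.
  exists a => e /imset2P[x y _]; rewrite inE => /andP[_ /eqP xy] ->.
  exact: xy.
have Hxy x y : x \in A -> y \in B -> cross_color x y = a ->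
    sub_adj H (val x) (val y) /\ sub_adj H (val y) (val x).
  move=> xA yB xy; rewrite /sub_adj [in X in _ /\ X]setUC.
  by have: [set val x; val y] \in E by apply/imset2P; exists x y; rewrite // inE yB xy eqxx.
suff W u v : u \in V -> v \in V -> exists2 n, walk_of_length H u v n & n <= 3.
  move=> u v /W Wu /Wu[n /distance_of_walk[d dist_d dn] n3].
  by exists d => //; apply: leq_trans n3.
(* Vertices on the same side are joined through a common neighbor; on opposite sides, one step to
   any neighbor in the block comes first. *)
move=> /setUP[] /imsetP[z zV ->] /setUP[] /imsetP[t tV ->].
- have [y yB [zy ty]] := rows z t zV tV.
  exists 2 => //; exists [:: val y; val t]; split=> //=.
  by rewrite (Hxy z y _ _ _).1 ?(Hxy t y _ _ _).2.
- have [y yB [zy _]] := rows z z zV zV; have [x xA [xy xt]] := cols y t yB tV.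
  exists 3 => //; exists [:: val y; val x; val t]; split=> //=.
  by rewrite (Hxy z y _ _ _).1 ?(Hxy x y _ _ _).2 ?(Hxy x t _ _ _).1.
- have [x xA [xz _]] := cols z z zV zV; have [y yB [ty xy]] := rows t x tV xA.
  exists 3 => //; exists [:: val x; val y; val t]; split=> //=.
  by rewrite (Hxy x z _ _ _).2 ?(Hxy x y _ _ _).1 ?(Hxy t y _ _ _).2.
- have [x xA [xz xt]] := cols z t zV tV.
  exists 2 => //; exists [:: val x; val t]; split=> //=.
  by rewrite (Hxy x z _ _ _).2 ?(Hxy x t _ _ _).1.
Qed.

End Bipartition.

(** A single part serves as [S], and a second part shows that its complement is nonempty. *)
Lemma multipartite_bipartition (G : sgraph) k : 2 <= k ->
  complete_multipartite G k ->
  exists S : {set G}, [/\ S != set0, ~: S != set0 &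
    forall x y : G, x \in S -> y \notin S -> adj x y].
Proof.
move=> k2 [P [partP cardP adjP]].
have /and3P[/eqP covP trivP P0] := partP.
have /card_gt1P[S [T [SP TP ST]]] : 1 < #|P| by rewrite cardP.
have P0' U : U \in P -> U != set0 by apply: contraTneq => ->.
exists S; split=> [||x y xS yS]; first exact: P0'.
  have /set0Pn[t tT] := P0' T TP; apply/set0Pn; exists t; rewrite inE.
  apply: contraNN ST => tS.
  by rewrite -(def_pblock trivP SP tS) (def_pblock trivP TP tT).
rewrite adjP (def_pblock trivP SP xS); apply: contraNneq yS => ->.
by rewrite mem_pblock covP.
Qed.

Theorem corollary1p4 (G : sgraph) (k : nat) (hk : 2 <= k)
    (hG : complete_multipartite G k) (c : coloring G) :
  exists H1 H2 : subgraph G,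
    [/\ monochromatic c H1, monochromatic c H2,
        diameter_at_most 3 H1, diameter_at_most 3 H2 &
        sub_verts H1 :|: sub_verts H2 = [set: G]].
Proof.
have [S [/set0Pn[x0 x0S] /set0Pn[y0]]] := multipartite_bipartition hk hG.
rewrite inE => y0S adjS.
have [a1 [A1 [B1 [a2 [A2 [B2 [b1 b2 A12 B12]]]]]]] :=
  two_blocks_exist (@cross_color G c S) (exist _ x0 x0S) (exist _ y0 y0S).
have [H1 V1 [m1 d1]] := block_subgraph adjS b1.
have [H2 V2 [m2 d2]] := block_subgraph adjS b2.
exists H1, H2; split=> //; rewrite V1 V2 setUACA -!imsetU A12 B12.
apply/setP => z; rewrite !inE; have [zS|zS] := boolP (z \in S).
  by rewrite (imset_f val (in_setT (exist _ z zS))).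
by rewrite [in X in _ || X](imset_f val (in_setT (exist _ z zS))) orbT.
Qed.
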